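(* For every $n\ge1$, the following identities of formal power series in $t$ hold: \[ \frac{B_n^{+}(t)}{(1-t)^{n+1}}=\sum_{k\ge0}\frac{(2k+1)^n+1}{2}\,t^k,\qquad \frac{B_n^{-}(t)}{(1-t)^{n+1}}=\sum_{k\ge0}\frac{(2k+1)^n-1}{2}\,t^k. \]
   Context: The hyperoctahedral group $B_n$ consists of bijections $w$ of $\{-n,\dots,n\}$ with $w(-i)=-w(i)$ for all $i$ (so $w(0)=0$), written $w=w(1)\cdots w(n)$. For $u\in S_n$ and $J\subseteq[n]$, $u^J\in B_n$ is given by $u^J(j)=u(j)$ for $j\notin J$ and $u^J(j)=-u(j)$ for $j\in J$; every $w\in B_n$ is uniquely of this form. The type B descent number is $\mathrm{des}_B(w)=|\{0\le i\le n-1: w(i)>w(i+1)\}|$ (with $w(0)=0$). The sign is $\mathrm{sgn}_B(u^J)=(-1)^{|J|}\mathrm{sgn}(u)$. Let $B_n^{\pm}=\{w\in B_n:\mathrm{sgn}_B(w)=\pm1\}$ and $B_n^{\pm}(t)=\sum_{w\in B_n^{\pm}}t^{\mathrm{des}_B(w)}$. *)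

(* Defs.v *)
From HB Require Import structures.
From mathcomp Require Import all_boot all_order all_algebra all_fingroup.
From mathcomp Require Import zify boolp.
Set Implicit Arguments.
Unset Strict Implicit.
Unset Printing Implicit Defensive.
Import Order.TTheory GRing.Theory Num.Theory.
Local Open Scope ring_scope.

Record fps (R : Type) := Fps { fcoef : nat -> R }.

Notation "\fps_ k E" := (Fps (fun k => E))
  (at level 36, k name, E at level 36, format "\fps_ k  E") : ring_scope.

HB.instance Definition _ (R : Type) := gen_eqMixin (fps R).
HB.instance Definition _ (R : Type) := gen_choiceMixin (fps R).

Lemma fpsP (R : Type) (f g : fps R) : (forall k, fcoef f k = fcoef g k) <-> f = g.
Proof.
split=> [|-> //]; case: f => f; case: g => g /= E.
by congr Fps; apply: funext.
Qed.

Section FpsZmodule.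
Variable R : zmodType.
Implicit Types f g h : fps R.

Definition fps_zero : fps R := \fps_k 0.
Definition fps_opp f : fps R := \fps_k (- fcoef f k).
Definition fps_add f g : fps R := \fps_k (fcoef f k + fcoef g k).

Fact fps_addA : associative fps_add.
Proof. by move=> f g h; apply/fpsP => k /=; rewrite addrA. Qed.
Fact fps_addC : commutative fps_add.
Proof. by move=> f g; apply/fpsP => k /=; rewrite addrC. Qed.
Fact fps_add0 : left_id fps_zero fps_add.
Proof. by move=> f; apply/fpsP => k /=; rewrite add0r. Qed.
Fact fps_addN : left_inverse fps_zero fps_opp fps_add.
Proof. by move=> f; apply/fpsP => k /=; rewrite addNr. Qed.

HB.instance Definition _ :=
  GRing.isZmodule.Build (fps R) fps_addA fps_addC fps_add0 fps_addN.

Lemma fcoef0 k : fcoef (0 : fps R) k = 0. Proof. by []. Qed.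
Lemma fcoefN f k : fcoef (- f) k = - fcoef f k. Proof. by []. Qed.
Lemma fcoefD f g k : fcoef (f + g) k = fcoef f k + fcoef g k. Proof. by []. Qed.
Lemma fcoefB f g k : fcoef (f - g) k = fcoef f k - fcoef g k. Proof. by []. Qed.

End FpsZmodule.

Section FpsRing.
Variable R : comNzRingType.
Implicit Types f g h : fps R.

Definition fps_one : fps R := \fps_k (k == 0)%:R.
Definition fps_mul f g : fps R :=
  \fps_k (\sum_(i < k.+1) fcoef f i * fcoef g (k - i)).

(* Truncation to polynomials transports the ring laws from {poly R}. *)
Definition fps_trunc m f : {poly R} := \poly_(i < m) fcoef f i.

Lemma fps_mul_trunc f g k m : (k < m)%N ->
  fcoef (fps_mul f g) k = (fps_trunc m f * fps_trunc m g)`_k.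
Proof.
move=> km; rewrite coefM; apply: eq_bigr => i _; rewrite !coef_poly.
by rewrite !ifT //; have := ltn_ord i; lia.
Qed.

Fact fps_mulC : commutative fps_mul.
Proof.
by move=> f g; apply/fpsP => k; rewrite !(@fps_mul_trunc _ _ _ k.+1) // mulrC.
Qed.

Fact fps_mulA : associative fps_mul.
Proof.
move=> f g h; apply/fpsP => k.
transitivity (fps_trunc k.+1 f * fps_trunc k.+1 g * fps_trunc k.+1 h)`_k.
  rewrite -mulrA coefM; apply: eq_bigr => i _; rewrite coef_poly ltn_ord.
  by congr (_ * _); apply: fps_mul_trunc; lia.
rewrite coefM; apply: eq_bigr => i _; rewrite [X in _ * X]coef_poly ifT; last lia.
by congr (_ * _); rewrite -fps_mul_trunc.
Qed.

Fact fps_mul1 : left_id fps_one fps_mul.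
Proof.
move=> f; apply/fpsP => k /=; rewrite big_ord_recl /= mul1r subn0 big1 ?addr0 //.
by move=> i _; rewrite mul0r.
Qed.

Fact fps_mulDl : left_distributive fps_mul +%R.
Proof.
move=> f g h; apply/fpsP => k /=; rewrite -big_split /=.
by apply: eq_bigr => i _; rewrite mulrDl.
Qed.

Fact fps_one_neq0 : fps_one != 0.
Proof.
by apply/eqP => /fpsP/(_ 0) /= /eqP; rewrite oner_eq0.
Qed.

HB.instance Definition _ := GRing.Zmodule_isComNzRing.Build (fps R)
  fps_mulA fps_mulC fps_mul1 fps_mulDl fps_one_neq0.

Lemma fcoef1 k : fcoef (1 : fps R) k = (k == 0)%:R. Proof. by []. Qed.
Lemma fcoefM f g k :
  fcoef (f * g) k = \sum_(i < k.+1) fcoef f i * fcoef g (k - i).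
Proof. by []. Qed.

Definition fps_of_poly (p : {poly R}) : fps R := \fps_k p`_k.

Fact fps_of_poly_is_additive : zmod_morphism fps_of_poly.
Proof. by move=> p q; apply/fpsP => k; rewrite fcoefB /= coefB. Qed.
Fact fps_of_poly_is_multiplicative : monoid_morphism fps_of_poly.
Proof.
split=> [|p q]; apply/fpsP => k; first by rewrite /= coef1.
by rewrite fcoefM /= coefM.
Qed.
HB.instance Definition _ :=
  GRing.isZmodMorphism.Build {poly R} (fps R) fps_of_poly fps_of_poly_is_additive.
HB.instance Definition _ :=
  GRing.isMonoidMorphism.Build {poly R} (fps R) fps_of_poly
    fps_of_poly_is_multiplicative.

Definition fpsX : fps R := fps_of_poly 'X.

End FpsRing.

Arguments fpsX {R}.

Section FpsUnitRing.
Variable R : comUnitRingType.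
Implicit Types f g h : fps R.

Definition fps_unit : {pred fps R} := fun f => fcoef f 0 \is a GRing.unit.

(* [fps_inv_seq f k] lists the coefficients 0, ..., k of the inverse of f. *)
Fixpoint fps_inv_seq f (k : nat) : seq R :=
  if k is k'.+1 then
    let s := fps_inv_seq f k' in
    rcons s (- (fcoef f 0)^-1 * \sum_(i < k) fcoef f (k - i) * s`_i)
  else [:: (fcoef f 0)^-1].

Definition fps_inv f : fps R :=
  if f \in fps_unit then \fps_k (fps_inv_seq f k)`_k else f.

Lemma size_fps_inv_seq f k : size (fps_inv_seq f k) = k.+1.
Proof. by elim: k => //= k IH; rewrite size_rcons IH. Qed.

Lemma nth_fps_inv_seq f k i : (i <= k)%N ->
  (fps_inv_seq f k)`_i = (fps_inv_seq f i)`_i.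
Proof.
elim: k => [|k IH]; first by rewrite leqn0 => /eqP ->.
rewrite leq_eqVlt => /predU1P[-> //|ik].
by rewrite /= nth_rcons size_fps_inv_seq ik IH.
Qed.

Fact fps_mulV : {in fps_unit, left_inverse 1 fps_inv *%R}.
Proof.
move=> f Uf; rewrite /fps_inv Uf; apply/fpsP => -[|k].
  by rewrite fcoefM big_ord_recr big_ord0 /= add0r mulVr.
rewrite fcoefM fcoef1 big_ord_recr /= subnn nth_rcons size_fps_inv_seq ltnn eqxx.
rewrite mulrAC mulNr mulVr // mulN1r; apply/eqP; rewrite subr_eq0; apply/eqP.
apply: eq_bigr => i _; rewrite mulrC; congr (_ * _).
by rewrite [RHS]nth_fps_inv_seq // -ltnS.
Qed.

Fact fps_unitPl f g : g * f = 1 -> fps_unit f.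
Proof.
move=> /fpsP/(_ 0); rewrite fcoefM big_ord_recr big_ord0 /= add0r => E.
by apply/unitrPr; exists (fcoef g 0); rewrite mulrC.
Qed.

Fact fps_inv_out : {in [predC fps_unit], fps_inv =1 id}.
Proof. by move=> f /negPf Uf; rewrite /fps_inv Uf. Qed.

HB.instance Definition _ := GRing.ComNzRing_hasMulInverse.Build (fps R)
  fps_mulV fps_unitPl fps_inv_out.

Lemma fps_unitE f : (f \is a GRing.unit) = (fcoef f 0 \is a GRing.unit).
Proof. by []. Qed.

Lemma fps_unit_1subX : 1 - fpsX \is a @GRing.unit (fps R).
Proof. by rewrite fps_unitE fcoefB /= coefX subr0 unitr1. Qed.

End FpsUnitRing.

Definition symint (n : nat) := {z : int | (`|z| <= n)%N}.

HB.instance Definition _ n := SubType.copy (symint n) {z : int | (`|z| <= n)%N}.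
HB.instance Definition _ n := Countable.copy (symint n) {z : int | (`|z| <= n)%N}.

Section SymInt.
Variable n : nat.

Definition symint_rank (z : symint n) : 'I_n.*2.+1 := inord `|val z + n%:Z|.

Fact symint0_subproof : (`|0 : int| <= n)%N. Proof. by []. Qed.
Definition symint0 : symint n := Sub (0 : int) symint0_subproof.

Definition symint_unrank (i : 'I_n.*2.+1) : symint n :=
  insubd symint0 (i%:Z - n%:Z).

Fact symint_rankK : cancel symint_rank symint_unrank.
Proof.
move=> z; have zn := valP z; apply: val_inj.
by rewrite /symint_unrank /symint_rank val_insubd inordK ?ifT; lia.
Qed.

HB.instance Definition _ : isFinite (symint n) := CanIsFinite symint_rankK.

Fact symint_opp_subproof (z : symint n) : (`|- val z| <= n)%N.
Proof. by rewrite abszN (valP z). Qed.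
Definition symint_opp (z : symint n) : symint n := Sub (- val z) (symint_opp_subproof z).

Lemma val_symint_opp z : val (symint_opp z) = - val z. Proof. by []. Qed.

End SymInt.

Section Hyperoctahedral.
Variable n : nat.
Implicit Types (w : {perm symint n}) (u : 'S_n) (J : {set 'I_n}).

Definition hyperoct : {set {perm symint n}} :=
  [set w : {perm symint n} | [forall z, w (symint_opp z) == symint_opp (w z)]].

(* w(i), for i an integer with -n <= i <= n. *)
Definition letter w (i : int) : int := val (w (insubd (symint0 n) i)).

(* u^J. The permutation u : 'S_n acts on {0, ..., n-1}: the classical
   value u(j+1) is (u j).+1, and J is likewise shifted by one. *)
Definition signed_val u J (z : int) : int :=
  if insub `|z|.-1 is Some j then
    Num.sg z * ((-1) ^+ (j \in J) * (u j).+1%:Z)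
  else 0.

Fact signed_val_subproof u J (z : symint n) : (`|signed_val u J (val z)| <= n)%N.
Proof.
rewrite /signed_val; case: insubP => //= j _ _.
rewrite !abszM abszX exp1n mul1n.
by have := ltn_ord (u j); case: (sgrP (val z)) => _; lia.
Qed.
Definition signed_fun u J (z : symint n) : symint n :=
  Sub (signed_val u J (val z)) (signed_val_subproof u J z).

Lemma val_signed_fun u J z : val (signed_fun u J z) = signed_val u J (val z).
Proof. by []. Qed.

Lemma signed_val0 u J : signed_val u J 0 = 0.
Proof. by rewrite /signed_val; case: insubP => // *; rewrite sgr0 mul0r. Qed.

Let sign_if (b : bool) : (-1) ^+ b = (if b then -1 else 1) :> int.
Proof. by case: b. Qed.

Lemma signed_valS u J (j : 'I_n) (b : bool) :
  signed_val u J ((-1) ^+ b * j.+1%:Z) = (-1) ^+ (b (+) (j \in J)) * (u j).+1%:Z.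
Proof.
have E : `|((-1) ^+ b * j.+1%:Z)%R|%N.-1 = j by rewrite abszM abszX exp1n mul1n.
rewrite /signed_val E valK signr_addb mulrA.
by congr (_ * _ * _); case: (b).
Qed.

Lemma symint_case (z : symint n) :
  val z = 0 \/ exists j : 'I_n, exists b : bool, val z = (-1) ^+ b * j.+1%:Z.
Proof.
move: (val z) (valP z) => {z}z zn; have [z0|z0] := eqVneq z 0; first by left.
have jn : (`|z|.-1 < n)%N by lia.
by right; exists (Ordinal jn), (z < 0); rewrite sign_if /=; case: ltrP => h; lia.
Qed.

Fact signed_fun_inj u J : injective (signed_fun u J).
Proof.
move=> z1 z2 /(congr1 val); rewrite !val_signed_fun => E.
apply: val_inj; move: E.
case: (symint_case z1) => [->|[j1 [b1 ->]]]; case: (symint_case z2) => [->|[j2 [b2 ->]]] //;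
  rewrite ?signed_val0 ?signed_valS //.
- by move=> E; exfalso; move: E; rewrite sign_if; case: ifP => _; lia.
- by move=> E; exfalso; move: E; rewrite sign_if; case: ifP => _; lia.
move=> E; have Eu : u j1 = u j2.
  by apply: val_inj => /=; move: E; rewrite !sign_if; do 2!case: ifP => _; lia.
move/perm_inj: Eu E => ->; move: (j2 \in J) => c.
by rewrite !sign_if; move: b1 b2 c => [] [] [] /=; lia.
Qed.

Definition signed_perm u J : {perm symint n} := perm (@signed_fun_inj u J).

Lemma letter_signed_perm u J (j : 'I_n) :
  letter (signed_perm u J) j.+1%:Z = (-1) ^+ (j \in J) * (u j).+1%:Z.
Proof.
rewrite /letter permE /= insubdK ?inE /=; last exact: ltn_ord.
by have := signed_valS u J j false; rewrite mul1r.
Qed.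

Lemma letter0 w : w \in hyperoct -> letter w 0 = 0.
Proof.
have E : insubd (symint0 n) (0 : int) = symint0 n.
  by apply: val_inj; rewrite insubdK.
have EN : symint_opp (symint0 n) = symint0 n.
  by apply: val_inj; rewrite val_symint_opp oppr0.
rewrite inE /letter E => /forallP/(_ (symint0 n))/eqP.
by rewrite EN => /(congr1 (fun z : symint n => val z))/eqP; rewrite val_symint_opp eq_sym eqNr => /eqP.
Qed.

Lemma signed_perm_hyperoct u J : signed_perm u J \in hyperoct.
Proof.
rewrite inE; apply/forallP => z; apply/eqP/val_inj.
rewrite !permE val_signed_fun !val_symint_opp val_signed_fun.
case: (symint_case z) => [->|[j [b ->]]]; first by rewrite oppr0 signed_val0.
rewrite -mulNr -signrN !signed_valS.
by rewrite !sign_if; case: b; case: (j \in J); rewrite /=; lia.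
Qed.

Lemma hyperoct_eq w1 w2 : w1 \in hyperoct -> w2 \in hyperoct ->
  (forall j : 'I_n, letter w1 j.+1%:Z = letter w2 j.+1%:Z) -> w1 = w2.
Proof.
move=> B1 B2 E; have E0 : letter w1 0 = letter w2 0 by rewrite !letter0.
apply/permP => z; move: B1 B2; rewrite !inE.
move=> /forallP/(_ z)/eqP O1 /forallP/(_ z)/eqP O2.
case: (symint_case z) => [Ez|[j [[] Ez]]].
- apply: val_inj; move: E0; rewrite /letter.
  by have -> : insubd (symint0 n) (0 : int) = z by rewrite -Ez valKd.
- have Ej : insubd (symint0 n) j.+1%:Z = symint_opp z.
    by apply: val_inj; rewrite insubdK ?inE /= ?Ez ?mulN1r ?opprK //; apply: ltn_ord.
  have := E j; rewrite /letter Ej O1 O2 /= => /oppr_inj; exact: val_inj.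
- have Ej : insubd (symint0 n) j.+1%:Z = z by rewrite -(valKd (symint0 n) z) Ez mul1r.
  by apply: val_inj; have := E j; rewrite /letter Ej.
Qed.

Lemma signed_perm_inj u1 J1 u2 J2 :
  signed_perm u1 J1 = signed_perm u2 J2 -> u1 = u2 /\ J1 = J2.
Proof.
move=> E; have H j : u1 j = u2 j /\ (j \in J1) = (j \in J2).
  have := congr1 (letter^~ j.+1%:Z) E; rewrite /= !letter_signed_perm !sign_if.
  by case: (j \in J1); case: (j \in J2) => /= F; split=> //; try apply: val_inj => /=; lia.
split; first by apply/permP => j; have [] := H j.
by apply/setP => j; have [] := H j.
Qed.

(* Every element of B_n is u^J for some u and J, unique by [signed_perm_inj]. *)
Lemma hyperoct_signed_perm w : w \in hyperoct -> exists u J, w = signed_perm u J.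
Proof.
move=> Bw; have w0 := letter0 Bw.
pose e (i : int) : symint n := insubd (symint0 n) i.
have val_e (i : int) : (`|i| <= n)%N -> val (e i) = i by move=> h; rewrite insubdK.
have letter_inj (i k : int) : (`|i| <= n)%N -> (`|k| <= n)%N ->
    letter w i = letter w k -> i = k.
  move=> hi hk /val_inj/perm_inj/(congr1 val).
  by rewrite -[LHS]/(val (e i)) -[RHS]/(val (e k)) !val_e.
have letterN (i : int) : (`|i| <= n)%N -> letter w (- i) = - letter w i.
  move=> hi; move: Bw; rewrite inE => /forallP/(_ (e i))/eqP/(congr1 val) /= <-.
  rewrite /letter -/(e (- i)); congr (sval (w _)); apply: val_inj.
  by rewrite val_e ?abszN //= val_e.
have jn (j : 'I_n) : (`|j.+1%:Z| <= n)%N by exact: ltn_ord.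
have letterS_neq0 (j : 'I_n) : letter w j.+1%:Z != 0.
  by apply/eqP; rewrite -w0 => /letter_inj E; have := E (jn j) isT.
have lt (j : 'I_n) : (`|letter w j.+1%:Z|.-1 < n)%N.
  have h : (`|letter w j.+1%:Z| <= n)%N := valP (w (e j.+1%:Z)).
  by move: (letterS_neq0 j) h; lia.
pose f j := Ordinal (lt j).
have f_inj : injective f.
  move=> j k /(congr1 val) /= E; apply: val_inj => /=.
  have [] : letter w j.+1%:Z = letter w k.+1%:Z
         \/ letter w j.+1%:Z = letter w (- k.+1%:Z).
    by rewrite letterN //; move: E (letterS_neq0 j) (letterS_neq0 k); lia.
  - by move/letter_inj => /(_ (jn j) (jn k)) [].
  - by move/letter_inj; rewrite abszN => /(_ (jn j) (jn k)).
exists (perm f_inj), [set j : 'I_n | letter w j.+1%:Z < 0].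
apply: hyperoct_eq => // [|j]; first exact: signed_perm_hyperoct.
rewrite letter_signed_perm permE inE sign_if /=.
by move: (letterS_neq0 j); case: ltrP => h; lia.
Qed.

(* sgn_B(u^J) = (-1)^|J| sgn(u); see [sgnB_signed_perm]. The value 0 is taken
   only outside B_n. *)
Definition sgnB w : int :=
  if [pick uJ : 'S_n * {set 'I_n} | w == signed_perm uJ.1 uJ.2] is Some uJ
  then (-1) ^+ #|uJ.2| * (-1) ^+ uJ.1 else 0.

Lemma sgnB_signed_perm u J : sgnB (signed_perm u J) = (-1) ^+ #|J| * (-1) ^+ u.
Proof.
rewrite /sgnB; case: pickP => [[u' J'] /= /eqP/signed_perm_inj[<- <-] //|].
by move/(_ (u, J)); rewrite eqxx.
Qed.

Definition desB w : nat :=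
  #|[set i : 'I_n | letter w i.+1%:Z < letter w i%:Z]|.

Definition hyperoct_pos : {set {perm symint n}} := [set w in hyperoct | sgnB w == 1].
Definition hyperoct_neg : {set {perm symint n}} := [set w in hyperoct | sgnB w == -1].

Definition descent_poly (A : {set {perm symint n}}) : {poly rat} :=
  \sum_(w in A) 'X^(desB w).

End Hyperoctahedral.

(* Main.v *)
Require Import Defs.
From HB Require Import structures.
From mathcomp Require Import all_boot all_order all_algebra all_fingroup.
From mathcomp Require Import zify lra.
Set Implicit Arguments.
Unset Strict Implicit.
Unset Printing Implicit Defensive.
Import Order.TTheory GRing.Theory Num.Theory.
Local Open Scope ring_scope.

(* The two series are recovered from their sum and their difference.

   Sum: a function f from [n] to {-k, ..., k} is compatible with a unique w in B_n,
   obtained by sorting the letters +-i (signed as f i) first by |f i| and then by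
   value. Read along w, the |f i| form a sequence 0 <= g_1 <= ... <= g_n <= k that is
   strict at the descents of w, so C(k + n - des_B(w), n) functions f are compatible
   with w. This gives sum_w C(k + n - des_B(w), n) = (2k + 1)^n.

   Difference: the signed descent polynomial is (1 - t)^n. For u <> 1 let m be the
   largest non-fixed point of u; in u^J the letter +-m stands to the left of position m,
   between two smaller letters, so changing its sign preserves des_B and flips the sign.
   Only u = 1 survives, where des_B(1^J) = |J|. *)

(** * Expansion of the powers of [1 / (1 - t)] *)

Lemma fcoef_fpsX (R : comNzRingType) k : fcoef (fpsX : fps R) k = (k == 1)%:R.
Proof. by rewrite /= coefX. Qed.

Lemma fcoef_fpsXnM (R : comNzRingType) (f : fps R) d k :
  fcoef (fpsX ^+ d * f) k = if (d <= k)%N then fcoef f (k - d) else 0.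
Proof.
elim: d k => [|d IH] k; first by rewrite mul1r subn0.
rewrite exprS -mulrA fcoefM; case: k => [|k].
  by rewrite big_ord1 fcoef_fpsX mul0r.
rewrite big_ord_recl big_ord_recl !fcoef_fpsX mul0r mul1r add0r big1 ?addr0.
  by rewrite -[(k.+1 - _)%N]/(k.+1 - 1)%N subn1 IH.
by move=> i _; rewrite fcoef_fpsX mul0r.
Qed.

(** By Pascal's rule, multiplying the series of [C(m + 1 + k, m + 1)] by [1 - t] gives the series of
    [C(m + k, m)]; induction descends to the geometric series. *)
Lemma fcoef_inv_1subXn (R : comUnitRingType) n k :
  fcoef ((1 - fpsX : fps R) ^- n.+1) k = 'C(n + k, n)%:R.
Proof.
pose g m : fps R := \fps_k 'C(m + k, m)%:R.
suff E m : (1 - fpsX) ^+ m.+1 * g m = 1.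
  have U : (1 - fpsX : fps R) ^+ n.+1 \is a GRing.unit.
    by rewrite unitrX // fps_unit_1subX.
  by have -> : (1 - fpsX) ^- n.+1 = g n by apply: (mulrI U); rewrite E mulrV.
elim: m => [|m IH].
  apply/fpsP => k'; rewrite expr1 mulrBl mul1r fcoefB -[fpsX]expr1 fcoef_fpsXnM.
  by rewrite /= !bin0; case: k' => [|k'] /=; rewrite ?subr0 ?subrr.
rewrite -[RHS]IH exprSr -mulrA; congr (_ * _); apply/fpsP => k'.
rewrite mulrBl mul1r fcoefB -[fpsX]expr1 fcoef_fpsXnM /=.
case: k' => [|k'] /=; first by rewrite !addn0 !binn subr0.
by rewrite subn1 /= addnS binS addSnnS natrD addrAC subrr add0r.
Qed.

Lemma fcoef_Xn_div_1subXn (R : comUnitRingType) n d k : (d <= n)%N ->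
  fcoef (fps_of_poly 'X^d / (1 - fpsX : fps R) ^+ n.+1) k = 'C(k + n - d, n)%:R.
Proof.
move=> dn; rewrite rmorphXn fcoef_fpsXnM fcoef_inv_1subXn.
(* When [k < d] the upper index [k + n - d] is below [n], so the binomial also vanishes. *)
case: leqP => h; first by congr ('C(_, _))%:R; lia.
by rewrite bin_small //; lia.
Qed.

(** * The signed descent polynomial *)

Lemma letter_signed_perm0 n (u : 'S_n) J : letter (signed_perm u J) 0 = 0.
Proof. exact/letter0/signed_perm_hyperoct. Qed.

Lemma desB_sum n (w : {perm symint n}) :
  desB w = (\sum_(i < n) (letter w i.+1%:Z < letter w i%:Z)%R)%N.
Proof.
by rewrite /desB -sum1_card big_mkcond /=; apply: eq_bigr => i _; rewrite inE; case: ifP.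
Qed.

(** Absolute values increase along [1^J], so the descents are exactly the steps into a negative
    letter. *)
Lemma desB_signed_id n (J : {set 'I_n}) : desB (signed_perm 1%g J) = #|J|.
Proof.
rewrite desB_sum -sum1_card [RHS]big_mkcond; apply: eq_bigr => i _.
rewrite letter_signed_perm perm1.
suff [lo hi] : - (i%:Z) <= letter (signed_perm 1%g J) i%:Z /\
    letter (signed_perm 1%g J) i%:Z <= i%:Z.
  case: (i \in J); rewrite ?expr0 ?expr1 ?mul1r ?mulN1r.
    by have -> : - i.+1%:Z < letter (signed_perm 1%g J) i%:Z by lia.
  by rewrite ltNge; have -> : letter (signed_perm 1%g J) i%:Z <= i.+1%:Z by lia.
case: i => -[|i] lt /=; first by rewrite letter_signed_perm0.
have := letter_signed_perm 1%g J (Ordinal (ltnW lt)); rewrite perm1 /= => ->.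
by case: (_ \in J); rewrite ?expr0 ?expr1; lia.
Qed.

Section Toggle.
Variables (n : nat) (u : 'S_n) (p : 'I_n).

Definition toggle (J : {set 'I_n}) : {set 'I_n} := [set j | (j \in J) (+) (j == p)].

Lemma toggleK : involutive toggle.
Proof. by move=> J; apply/setP => j; rewrite !inE addbK. Qed.

Lemma sign_toggle J : (-1) ^+ #|toggle J| = - (-1) ^+ #|J| :> int.
Proof.
wlog pJ : J / p \notin J => [H|].
  have [pJ|/H//] := boolP (p \in J).
  by rewrite -[in RHS](toggleK J) (H (toggle J)) ?opprK ?inE ?pJ ?eqxx.
suff -> : toggle J = p |: J by rewrite cardsU1 pJ exprS mulN1r.
by apply/setP => j; rewrite !inE; case: eqVneq => [->|]; rewrite ?(negPf pJ) ?addbF.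
Qed.

(* The letter of largest absolute value among its neighbours is a peak or a
   valley, so it accounts for exactly one descent either way. *)
Lemma desB_toggle J (q : 'I_n) : q = p.+1 :> nat ->
  (forall j : 'I_n, (j <= q)%N -> (u j <= u p)%N) ->
  desB (signed_perm u (toggle J)) = desB (signed_perm u J).
Proof.
move=> qp max_p; have qNp : q != p by rewrite -val_eqE /= qp; lia.
have nbr (j : 'I_n) : (j <= q)%N -> j != p -> (u j < u p)%N.
  move=> jq jp; rewrite ltn_neqAle max_p // andbT.
  by apply: contraNneq jp => /val_inj/perm_inj ->.
have same I (j : 'I_n) : j != p ->
    letter (signed_perm u (toggle I)) j.+1%:Z = letter (signed_perm u I) j.+1%:Z.
  by move=> jp; rewrite !letter_signed_perm inE (negPf jp) addbF.
have one I : ((letter (signed_perm u I) p.+1%:Z < letter (signed_perm u I) p%:Z)%R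
            + (letter (signed_perm u I) q.+1%:Z < letter (signed_perm u I) q%:Z)%R = 1)%N.
  rewrite !letter_signed_perm qp letter_signed_perm.
  have uq := nbr q (leqnn q) qNp.
  (* The letter at [p.+1] has absolute value [(u p).+1], so these bounds make it dominate its left
     neighbour strictly; for [p = 0] that neighbour is [w(0) = 0]. *)
  have [lo hi] : - (u p)%:Z <= letter (signed_perm u I) p%:Z /\
      letter (signed_perm u I) p%:Z <= (u p)%:Z.
    case Ep: (nat_of_ord p) => [|p']; first by rewrite letter_signed_perm0; lia.
    have lt : (p' < n)%N by have := ltn_ord p; lia.
    have := letter_signed_perm u I (Ordinal lt) => /= ->.
    have /= := nbr (Ordinal lt); rewrite -val_eqE /= qp Ep => /(_ ltac:(lia) ltac:(lia)).
    by case: (_ \in I); rewrite ?expr0 ?expr1; lia.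
  by case: (p \in I); case: (q \in I); rewrite ?expr0 ?expr1 ?mul1r ?mulN1r; lia.
rewrite !desB_sum (bigD1 p) // (bigD1 q) //= addnA one.
rewrite [RHS](bigD1 p) // [in RHS](bigD1 q) //= addnA one; congr (_ + _)%N.
apply: eq_bigr => i /andP[ip iq]; rewrite same //.
case: i ip iq => -[|i] lt /= ip iq; first by rewrite !letter_signed_perm0.
have := same J (Ordinal (ltnW lt)); rewrite -!val_eqE /= => -> //.
by move: iq; rewrite -val_eqE /= qp eqSS.
Qed.

End Toggle.

Lemma signed_sum_nontrivial n (u : 'S_n) : u != 1%g ->
  \sum_(J : {set 'I_n}) (-1) ^+ #|J| * 'X^(desB (signed_perm u J)) = 0 :> {poly rat}.
Proof.
move=> u1; have [m0 m0P] : exists m, u m != m.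
  apply/existsP; apply: contraNT u1; rewrite negb_exists => /forallP H.
  by apply/eqP/permP => i; rewrite perm1; apply/eqP; move: (H i); rewrite negbK.
case: (@arg_maxnP _ m0 (fun m => u m != m) (fun m => val m) m0P) => m um mmax.
pose p := (u^-1)%g m; have up : u p = m by rewrite permKV.
have pNm : p != m by apply: contraNneq um => E; rewrite -{1}E up.
have fixed (j : 'I_n) : (m < j)%N -> u j = j.
  by move=> mj; apply/eqP; apply: contraTT mj => /mmax; rewrite -leqNgt.
have pm : (p < m)%N.
  rewrite ltn_neqAle pNm leqNgt; apply: contra pNm => /fixed; rewrite up.
  by move=> {1}->.
have qn : (p.+1 < n)%N by have := ltn_ord m; lia.
have des J : desB (signed_perm u (toggle p J)) = desB (signed_perm u J).
  apply: (@desB_toggle n u p J (Ordinal qn)) => //= j jq; rewrite up leqNgt.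
  (* If [u j > m], then [u] fixes [u j], and injectivity gives [u j = j]; but [j <= p.+1 <= m]. *)
  by apply/negP => mu; have /perm_inj E := fixed _ mu; move: mu; rewrite E; lia.
set S := (X in X = 0).
have SN : S = - S.
  rewrite {1}/S (reindex_inj (inv_inj (toggleK p))) /= -sumrN.
  apply: eq_bigr => J _; rewrite des -mulNr; congr (_ * _).
  have := congr1 (fun z : int => z%:~R : {poly rat}) (sign_toggle p J).
  by rewrite rmorphN /= !rmorph_sign.
apply/polyP => i; have := congr1 (coefp i) SN; rewrite /= coefN coef0 => E.
lra.
Qed.

Lemma signed_sum n :
  \sum_(u : 'S_n) \sum_(J : {set 'I_n})
    (-1) ^+ #|J| * (-1) ^+ u * 'X^(desB (signed_perm u J)) = (1 - 'X) ^+ n :> {poly rat}.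
Proof.
rewrite (bigD1 1%g) //= [X in _ + X]big1 ?addr0 => [|u /signed_sum_nontrivial E]; last first.
  rewrite -[RHS](mulr0 ((-1) ^+ u)) -[in RHS]E mulr_sumr; apply: eq_bigr => J _.
  by rewrite [X in X * _]mulrC mulrA.
(* Expanding the product, [J] records the factors that contribute [- 'X]. *)
have -> : (1 - 'X) ^+ n = \prod_(i < n) (- 'X + 1) :> {poly rat}.
  by rewrite prodr_const card_ord addrC.
rewrite bigA_distr; apply: eq_bigr => J _.
by rewrite odd_perm1 mulr1 desB_signed_id -big_mkcond prodr_const -exprNn.
Qed.

(** * Functions from [[n]] to [{-k, ..., k}] and their sorting permutations *)

Lemma card_symint k : #|{: symint k}| = (2 * k + 1)%N.
Proof.
suff /bij_eq_card -> : bijective (@symint_rank k) by rewrite card_ord; lia.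
exists (@symint_unrank k); first exact: symint_rankK.
move=> i; apply: ord_inj; have := ltn_ord i => lt.
have v : val (symint_unrank i) = i%:Z - k%:Z by rewrite val_insubd ifT; lia.
by rewrite /symint_rank v inordK; lia.
Qed.

Definition sorts n (K : 'I_n -> int) (u : 'S_n) :=
  [forall i : 'I_n, forall j : 'I_n, (i < j)%N ==> (K (u i) < K (u j))].

Lemma sortsP n (K : 'I_n -> int) (u : 'S_n) :
  reflect (forall i j : 'I_n, (i < j)%N -> K (u i) < K (u j)) (sorts K u).
Proof.
by apply: (iffP 'forall_'forall_implyP).
Qed.

(** The sorting permutation is the inverse of the rank map, where the rank of [i] is the number of
    smaller keys. *)
Lemma sorts_exists_unique n (K : 'I_n -> int) : injective K ->
  exists u : 'S_n, forall v, sorts K v = (v == u).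
Proof.
move=> K_inj; pose below i := [set i' | K i' < K i].
have below_mono i i' : K i < K i' -> (#|below i| < #|below i'|)%N.
  move=> lt; apply/proper_card/properP; split.
    by apply/subsetP => x; rewrite !inE => /lt_trans; apply.
  by exists i; rewrite !inE ?ltxx.
have below_lt i : (#|below i| < n)%N.
  rewrite -[X in (_ < X)%N]card_ord -cardsT; apply/proper_card/properP; split.
    exact: subsetT.
  by exists i; rewrite !inE ?ltxx.
pose rank i := Ordinal (below_lt i).
have rank_inj : injective rank.
  move=> i i' /(congr1 val) /= E; apply: K_inj.
  by case: (ltgtP (K i) (K i')) => // /below_mono; rewrite E ltnn.
exists (perm rank_inj)^-1%g => v; apply/sortsP/eqP => [v_mono|-> i j ij].
  apply/permP => i; apply: (@perm_inj _ (perm rank_inj)); rewrite permKV permE.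
  apply: val_inj => /=.
  (* When [v] sorts [K], the indices with keys below that of [v i] are the images of the positions
     before [i], so [v i] has rank [i]. *)
  have -> : below (v i) = v @: [set j : 'I_n | (j < i)%N].
    apply/setP => x; rewrite -[x](permKV v) mem_imset ?inE; last exact: perm_inj.
    case: (ltngtP (v^-1%g x) i) => [/v_mono//|/v_mono/ltW|/val_inj ->].
      by rewrite ltNge => ->.
    by rewrite ltxx.
  rewrite card_imset; last exact: perm_inj.
  rewrite -sum1dep_card (big_ord_narrow (ltnW (ltn_ord i))) sum1_card card_ord //.
rewrite ltNge le_eqVlt; apply/norP; split.
  by apply/eqP => /K_inj/perm_inj E; rewrite E ltnn in ij.
apply/negP => /below_mono.
have rk x : #|below ((perm rank_inj)^-1%g x)| = x.
  by rewrite -[in RHS](permKV (perm rank_inj) x) [in RHS]permE.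
by rewrite !rk; lia.
Qed.

(** The low parts are balanced digits in base [2 * N + 1]: they differ by at most [2 * N], so the
    high parts decide. *)
Lemma ltr_lex_digits (N a b s t : int) :
  `|s| <= N -> `|t| <= N -> a < b -> a * (2 * N + 1) + s < b * (2 * N + 1) + t.
Proof.
move=> sN tN ab; have : 0 <= (b - a - 1) * (2 * N + 1) by apply: mulr_ge0; lia.
by lia.
Qed.

(* Comparing keys amounts to comparing the pairs ([`|f i|], [i] with the sign of
   [f i]) lexicographically. *)
Definition key n k (f : {ffun 'I_n -> symint k}) (i : 'I_n) : int :=
  `|val (f i)| * (2 * n%:Z + 1) + (-1) ^+ (val (f i) < 0)%R * i.+1%:Z.

Lemma key_inj n k (f : {ffun 'I_n -> symint k}) : injective (key f).
Proof.
have bnd (i : 'I_n) : `|(-1) ^+ (val (f i) < 0)%R * i.+1%:Z| <= n%:Z :> int.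
  by rewrite normrM normrX normrN1 expr1n mul1r; have := ltn_ord i; lia.
move=> i j; rewrite /key.
case: (ltgtP `|val (f i)| `|val (f j)|) => [lt|lt|->].
- by have := ltr_lex_digits (bnd i) (bnd j) lt; lia.
- by have := ltr_lex_digits (bnd j) (bnd i) lt; lia.
move=> /addrI E; apply: ord_inj; move: E.
by case: (val (f i) < 0); case: (val (f j) < 0); rewrite ?expr0 ?expr1; lia.
Qed.

Definition compatible n k (f : {ffun 'I_n -> symint k}) (u : 'S_n) (J : {set 'I_n}) :=
  sorts (key f) u && (J == [set j | val (f (u j)) < 0]).

(** * Counting the functions compatible with a fixed [u^J] *)

Section Compatible.
Variables (n' k : nat).
Let n := n'.+1.
Variables (u : 'S_n) (J : {set 'I_n}).

Let L i := letter (signed_perm u J) i%:Z.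
Let D i := (\sum_(j < i) (L j.+1 < L j)%R)%N.
(** Alphabet size for the strictly increasing tuples in [T] below: [D n] is the descent number, so
    they number [C(m, n)], the count sought. *)
Let m := (k + n - D n)%N.

Let L0 : L 0 = 0. Proof. exact: letter_signed_perm0. Qed.

Let LS (j : 'I_n) : L j.+1 = (-1) ^+ (j \in J) * (u j).+1%:Z.
Proof. exact: letter_signed_perm. Qed.

Let L_bound i : `|L i| <= n%:Z.
Proof.
have val_bound (z : symint n) : `|val z| <= n%:Z by have := valP z; lia.
exact: val_bound.
Qed.

Let L_neq i : (i.+1 < n)%N -> L i.+1 != L i.+2.
Proof.
move=> lt; have lt' : (i < n)%N by lia.
have := LS (Ordinal lt') => /= ->; have := LS (Ordinal lt) => /= ->.
have : u (Ordinal lt') != u (Ordinal lt) by rewrite (inj_eq perm_inj) -val_eqE /=; lia.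
rewrite -val_eqE /= => une.
by case: (_ \in J); case: (_ \in J); rewrite ?expr0 ?expr1; lia.
Qed.

Let DS i : D i.+1 = (D i + (L i.+1 < L i)%R)%N.
Proof. by rewrite /D big_ord_recr. Qed.

Let D_mono i d : (D i <= D (i + d) <= D i + d)%N.
Proof.
elim: d => [|d IH]; first by rewrite !addn0 leqnn.
by rewrite addnS DS; case: (_ < _); lia.
Qed.

(** The word starts at 0 and needs a descent to become negative. Hence [phi] below takes nonzero
    values wherever [J] prescribes a minus sign. *)
Let D_gt0 i : L i < 0 -> (0 < D i)%N.
Proof.
elim: i => [|i IH]; first by rewrite L0.
by rewrite DS; case: (ltP (L i.+1) (L i)); lia.
Qed.

Let H (t : n.-tuple 'I_m) j := nth 0%N [seq val i | i <- t] j.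
Let T := [set t : n.-tuple 'I_m | sorted ltn [seq val i | i <- t]].

Let H_lt t i j : t \in T -> (i < j < n)%N -> (H t i < H t j)%N.
Proof.
rewrite inE => /(sorted_ltn_nth ltn_trans 0%N) h /andP[ij jn].
by apply: h => //; rewrite inE size_map size_tuple -/n; lia.
Qed.

Let H_ge t j : t \in T -> (j < n)%N -> (j <= H t j)%N.
Proof.
move=> tT; elim: j => // j IH jn; have := IH (ltnW jn).
by have := @H_lt t j j.+1 tT; lia.
Qed.

Let H_tnth t (j : 'I_n) : H t j = tnth t j.
Proof. by rewrite /H (nth_map (tnth t j)) ?size_tuple ?ltn_ord // -tnth_nth. Qed.

Let H_le t j d : t \in T -> (j + d = n')%N -> (H t j + d < m)%N.
Proof.
move=> tT; elim: d j => [|d IH] j jn.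
  have lt : (j < n)%N by rewrite /n; lia.
  by rewrite addn0 (H_tnth t (Ordinal lt)).
have := IH j.+1 ltac:(lia).
by have := @H_lt t j j.+1 tT ltac:(rewrite /n; lia); lia.
Qed.

(* The inverse of the standardization that makes the weakly increasing sequence of
   absolute values [`|f (u j)|] strictly increasing. *)
Let phi (t : n.-tuple 'I_m) : {ffun 'I_n -> symint k} :=
  [ffun i => let j := (u^-1)%g i in
     insubd (symint0 k) ((-1) ^+ (j \in J) * (H t j + D j.+1 - j)%N%:Z)].

Let phi_u t j : t \in T ->
  val (phi t (u j)) = (-1) ^+ (j \in J) * (H t j + D j.+1 - j)%N%:Z.
Proof.
(* The default of [insubd] is avoided: [H t j - j <= k - D n] and [D j.+1 <= D n] bound the absolute
   value by [k]. *)
move=> tT; rewrite ffunE permK val_insubd ifT // abszM abszX exp1n mul1n.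
have jn : (j < n'.+1)%N := ltn_ord j.
have := @H_le t j (n' - j) tT (subnKC (jn : (j <= n')%N)).
have := D_mono j.+1 (n - j.+1); rewrite subnKC //.
by rewrite /m /n; lia.
Qed.

Let phi_inj : {in T &, injective phi}.
Proof.
move=> s t sT tT E; apply: eq_from_tnth => j; apply: ord_inj; rewrite -!H_tnth.
have := congr1 (fun f : {ffun 'I_n -> symint k} => val (f (u j))) E.
rewrite /= !phi_u //.
have := H_ge sT (ltn_ord j); have := H_ge tT (ltn_ord j).
by case: (j \in J); rewrite ?expr0 ?expr1; lia.
Qed.

Let phi_compatible t : t \in T -> compatible (phi t) u J.
Proof.
move=> tT.
have EJ j : (val (phi t (u j)) < 0) = (j \in J).
  rewrite phi_u //; have := H_ge tT (ltn_ord j); have := @D_gt0 j.+1.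
  by rewrite LS; case: (j \in J); rewrite ?expr0 ?expr1; lia.
apply/andP; split; last by apply/eqP/setP => j; rewrite inE EJ.
pose M j := (H t j + D j.+1 - j)%N%:Z * (2 * n%:Z + 1) + L j.+1.
have EM (j : 'I_n) : key (phi t) (u j) = M j.
  rewrite /key EJ /M LS phi_u // normrM normrX normrN1 expr1n mul1r.
  by congr (_ * _ + _); lia.
have stepM i : (i.+1 < n)%N -> M i < M i.+1.
  move=> lt; rewrite /M; have h := @H_lt t i i.+1 tT ltac:(lia).
  have h1 := H_ge tT lt; have h0 := H_ge tT (ltnW lt).
  (* The high digit never decreases, since [H] grows by at least 1 and [D] is monotone. A tie forces
     [D] to stay constant, so there is no descent and the low digit [L] increases. *)
  have [le|gt] := leqP (H t i.+1 + D i.+2 - i.+1) (H t i + D i.+1 - i).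
    have dS := DS i.+1; have ne := L_neq lt.
    have -> : (H t i.+1 + D i.+2 - i.+1 = H t i + D i.+1 - i)%N by lia.
    by rewrite ltrD2l; move: dS; case: ltgtP ne => //; lia.
  by apply: ltr_lex_digits; rewrite ?L_bound //; lia.
apply/sortsP => i j ij; rewrite !EM.
have -> : (j = i + (j - i).-1.+1 :> nat)%N by lia.
have : (i + (j - i).-1.+1 < n)%N by have := ltn_ord j; lia.
elim: (j - i).-1 => [|d IH] lt; first by rewrite addn1; apply: stepM; lia.
by rewrite addnS; apply: (lt_trans (IH _)); [lia | apply: stepM; lia].
Qed.

(** Surjectivity of [phi]: the absolute values along [u^J] increase at least as fast as [D], so
    adding [j] and subtracting [D j.+1] leaves a strictly increasing sequence. *)
Let compatible_phi f : compatible f u J -> exists2 t, t \in T & f = phi t.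
Proof.
case/andP => /sortsP f_sorts /eqP EJ.
pose G j := `|val (f (u (inord j)))|%N.
have GE (j : 'I_n) : G j = `|val (f (u j))|%N by rewrite /G inord_val.
have EK (j : 'I_n) : key f (u j) = (G j)%:Z * (2 * n%:Z + 1) + L j.+1.
  by rewrite /key LS GE EJ inE; congr (_ * _ + _); lia.
(* A descent at position 0 means a negative first letter, hence a nonzero value of [f] there. *)
have G0 : (D 1 <= G 0)%N.
  rewrite DS /D big_ord0 L0 (LS ord0) EJ inE (GE ord0).
  by case: (ltrP (val (f (u ord0))) 0) => h; rewrite ?expr0 ?expr1; lia.
(* If [G] ties, sortedness of the keys makes [L] increase; so [G] must grow strictly at a
   descent. *)
have GS j : (j.+1 < n)%N -> (G j + D j.+2 <= G j.+1 + D j.+1)%N.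
  move=> lt; have lt' := ltnW lt.
  have := f_sorts (Ordinal lt') (Ordinal lt) (ltnSn j); rewrite !EK /= (DS j.+1).
  case: (ltngtP (G j) (G j.+1)) => [g _|g|->].
  - by case: (_ < _); lia.
  - have := @ltr_lex_digits n (G j.+1) (G j) (L j.+2) (L j.+1) (L_bound _) (L_bound _).
    by lia.
  by rewrite ltrD2l => /ltW; rewrite leNgt; case: (_ < _); lia.
have DG j : (j < n)%N -> (D j.+1 <= G j)%N.
  elim: j => // j IH lt; have := IH (ltnW lt); have := @GS _ lt; lia.
have lt (j : 'I_n) : (G j + j - D j.+1 < m)%N.
  have jn := ltn_ord j; have := D_mono j.+1 (n - j.+1); rewrite subnKC //.
  have := valP (f (u j)); rewrite -GE /m.
  by have := @DG _ jn; lia.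
pose t := [tuple Ordinal (lt j) | j < n].
have Ht (j : 'I_n) : H t j = (G j + j - D j.+1)%N by rewrite H_tnth tnth_mktuple.
have tT : t \in T.
  rewrite inE; apply/(sortedP 0%N) => i; rewrite size_map size_tuple -/n => h.
  rewrite -!/(H t _) (Ht (Ordinal h)) (Ht (Ordinal (ltnW h))) /=.
  by have := @DG _ h; have := @GS _ h; have := @DG _ (ltnW h); lia.
exists t => //; apply/ffunP => i; rewrite -(permKV u i); set j := (u^-1)%g i.
apply: val_inj; rewrite phi_u // Ht EJ inE.
have := @DG _ (ltn_ord j) => h.
have -> : (G j + j - D j.+1 + D j.+1 - j = G j)%N by lia.
by rewrite GE [LHS]intEsign.
Qed.

Lemma card_compatible :
  #|[set f : {ffun 'I_n -> symint k} | compatible f u J]|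
    = 'C(k + n - desB (signed_perm u J), n).
Proof.
rewrite desB_sum -/(D n) -/m -card_ltn_sorted_tuples -/T -(card_in_imset phi_inj).
apply: eq_card => f; rewrite inE; apply/idP/imsetP => [/compatible_phi//|[t tT ->]].
exact: phi_compatible.
Qed.

End Compatible.

(** * Sums over [B_n] and the coefficients of the two series *)

Lemma sum_hyperoct (R : nmodType) n (P : pred {perm symint n})
    (F : {perm symint n} -> R) :
  \sum_(w in hyperoct n | P w) F w =
  \sum_(u : 'S_n) \sum_(J : {set 'I_n} | P (signed_perm u J)) F (signed_perm u J).
Proof.
pose sp (uJ : 'S_n * {set 'I_n}) := signed_perm uJ.1 uJ.2.
have -> : hyperoct n = sp @: setT.
  apply/setP => w; apply/idP/imsetP => [/hyperoct_signed_perm[u [J ->]]|[uJ _ ->]].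
    by exists (u, J).
  exact: signed_perm_hyperoct.
rewrite pair_big_dep /= big_mkcondr big_imset /=; last first.
  by move=> [u J] [v I] _ _ /signed_perm_inj[/= -> ->].
by rewrite [RHS]big_mkcond; apply: eq_bigl => uJ; rewrite inE.
Qed.

Lemma sum_bin_desB n k : (0 < n)%N ->
  (\sum_(u : 'S_n) \sum_(J : {set 'I_n}) 'C(k + n - desB (signed_perm u J), n)
    = (2 * k + 1) ^ n)%N.
Proof.
case: n => // n _.
transitivity (\sum_(u : 'S_n.+1) \sum_(J : {set 'I_n.+1})
    \sum_(f : {ffun 'I_n.+1 -> symint k}) compatible f u J)%N.
  apply: eq_bigr => u _; apply: eq_bigr => J _; rewrite -card_compatible -sum1dep_card.
  by rewrite big_mkcond; apply: eq_bigr => f _; case: compatible.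
rewrite pair_big /= exchange_big /= (eq_bigr (fun=> 1%N)).
  by rewrite sum1_card card_ffun card_symint card_ord.
(* Each [f] is counted once: its distinct keys determine [u], and its signs read along [u] determine
   [J]. *)
move=> f _; have [u uP] := sorts_exists_unique (key_inj (f := f)).
rewrite (bigD1 (u, [set j | val (f (u j)) < 0])) //= /compatible uP !eqxx big1 //.
case=> v J /=; rewrite xpair_eqE negb_and uP.
by case: eqP => //= -> /negPf ->.
Qed.

Lemma desB_le n (w : {perm symint n}) : (desB w <= n)%N.
Proof. by rewrite -[X in (_ <= X)%N]card_ord max_card. Qed.

(** Turning the sign condition into a coefficient lets the cases [s = 1] and [s = -1] be combined
    term by term. *)
Lemma descent_poly_sgnB n (s : int) :
  descent_poly [set w in hyperoct n | sgnB w == s] =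
  \sum_(u : 'S_n) \sum_(J : {set 'I_n})
    ((-1) ^+ #|J| * (-1) ^+ u == s)%:R * 'X^(desB (signed_perm u J)).
Proof.
have E := sum_hyperoct (fun w => sgnB w == s) (fun w => 'X^(desB w) : {poly rat}).
rewrite /descent_poly; under eq_bigl => w do rewrite inE.
rewrite E; apply: eq_bigr => u _; rewrite big_mkcond; apply: eq_bigr => J _.
by rewrite sgnB_signed_perm; case: eqP; rewrite ?mul1r ?mul0r.
Qed.

Lemma fcoef_sum (R : zmodType) I (r : seq I) (F : I -> fps R) k :
  fcoef (\sum_(i <- r) F i) k = \sum_(i <- r) fcoef (F i) k.
Proof. exact: (big_morph (fun f => fcoef f k)). Qed.

Lemma fcoef_descent_polyD n k : (0 < n)%N ->
  fcoef (fps_of_poly (descent_poly (hyperoct_pos n) + descent_poly (hyperoct_neg n))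
           / (1 - fpsX) ^+ n.+1) k = (2 * k + 1)%:R ^+ n.
Proof.
move=> n_gt0.
have -> : descent_poly (hyperoct_pos n) + descent_poly (hyperoct_neg n) =
    \sum_(u : 'S_n) \sum_(J : {set 'I_n}) 'X^(desB (signed_perm u J)).
  rewrite !descent_poly_sgnB -big_split; apply: eq_bigr => u _.
  rewrite -big_split; apply: eq_bigr => J _; rewrite /= -mulrDl.
  (* The sign is a power of -1, so exactly one of the two indicators equals 1. *)
  rewrite -[RHS]mul1r; congr (_ * _); rewrite -signr_odd -signr_addb.
  by case: (_ (+) _); rewrite ?expr1 ?expr0 ?eqxx /= ?addr0 ?add0r.
rewrite rmorph_sum mulr_suml fcoef_sum -natrX -sum_bin_desB // natr_sum.
apply: eq_bigr => u _; rewrite rmorph_sum mulr_suml fcoef_sum natr_sum.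
by apply: eq_bigr => J _; rewrite fcoef_Xn_div_1subXn // desB_le.
Qed.

Lemma fcoef_descent_polyB n k :
  fcoef (fps_of_poly (descent_poly (hyperoct_pos n) - descent_poly (hyperoct_neg n))
           / (1 - fpsX) ^+ n.+1) k = 1.
Proof.
have -> : descent_poly (hyperoct_pos n) - descent_poly (hyperoct_neg n) = (1 - 'X) ^+ n.
  rewrite -signed_sum !descent_poly_sgnB -sumrB; apply: eq_bigr => u _.
  rewrite -sumrB; apply: eq_bigr => J _; rewrite -mulrBl; congr (_ * _).
  rewrite -signr_odd -[in RHS]signr_odd -!signr_addb.
  by case: (_ (+) _); rewrite ?expr1 ?expr0 ?eqxx /= ?subr0 ?sub0r.
have U := fps_unit_1subX rat.
have -> : fps_of_poly ((1 - 'X) ^+ n) / (1 - fpsX) ^+ n.+1 = (1 - fpsX) ^- 1 :> fps rat.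
  by rewrite rmorphXn rmorphB rmorph1 exprS invrM ?unitrX // mulrA mulrV ?unitrX // mul1r.
by rewrite fcoef_inv_1subXn bin0.
Qed.

Theorem theorem5p2 (n : nat) (hn : (1 <= n)%N) :
  fps_of_poly (descent_poly (hyperoct_pos n)) / (1 - fpsX) ^+ n.+1
    = \fps_k (((2 * k + 1)%:R ^+ n + 1) / 2%:R : rat)
  /\
  fps_of_poly (descent_poly (hyperoct_neg n)) / (1 - fpsX) ^+ n.+1
    = \fps_k (((2 * k + 1)%:R ^+ n - 1) / 2%:R : rat).
Proof.
split; apply/fpsP => k; rewrite [RHS]/=;
  have := fcoef_descent_polyD k hn; rewrite rmorphD mulrDl fcoefD => ED;
  have := fcoef_descent_polyB n k; rewrite rmorphB mulrBl fcoefB => EB; lra.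
Qed.
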